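(* Let $f\colon\mathbb{R}^d\to\mathbb{R}$ be a CPWL function and let $\mathcal{C}$ be a polyhedral complex in $\mathbb{R}^d$. Let $H_f=\{(g,h)\mid f=g-h\}$ be the affine subspace of pairs $(g,h)$ of elements of $\mathrm{CPWL}_d/\mathrm{Aff}(\mathbb{R}^d)$ with $f=g-h$. Then $\mathcal{D}_{\mathcal{C}}(f)$ is a polyhedron, and $$\mathcal{D}_{\mathcal{C}}(f)=\bigl(\overline{\mathcal{V}}_{\mathcal{C}}^{+}\times\overline{\mathcal{V}}_{\mathcal{C}}^{+}\bigr)\cap H_f .$$ Moreover, under the projection $\pi((g,h))=g$, which is injective on $\mathcal{D}_{\mathcal{C}}(f)$, the image is the intersection of two shifted copies of the polyhedral cone $\overline{\mathcal{V}}_{\mathcal{C}}^{+}$, namely $$\pi(\mathcal{D}_{\mathcal{C}}(f))=\overline{\mathcal{V}}_{\mathcal{C}}^{+}\cap\bigl(\overline{\mathcal{V}}_{\mathcal{C}}^{+}+f\bigr).$$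
   Context: A polyhedral complex $\mathcal{C}$ in $\mathbb{R}^d$ is a finite collection of polyhedra containing $\emptyset$, closed under taking faces, such that any two members intersect in a common face; $\mathcal{C}^k$ denotes its $k$-dimensional members. All polyhedral complexes are assumed pure of dimension $d$ and complete (the union of the members is $\mathbb{R}^d$). A function $f\colon\mathbb{R}^d\to\mathbb{R}$ is CPWL (continuous and piecewise linear) if there is such a complex $\mathcal{C}$ with $f$ affine on every member of $\mathcal{C}$; then $f$ and $\mathcal{C}$ are called compatible. $\mathrm{CPWL}_d$ is the vector space of CPWL functions on $\mathbb{R}^d$ and $\mathrm{Aff}(\mathbb{R}^d)$ the space of affine functions. $\mathcal{V}_{\mathcal{C}}$ is the (finite-dimensional) vector space of CPWL functions compatible with $\mathcal{C}$, $\overline{\mathcal{V}}_{\mathcal{C}}=\mathcal{V}_{\mathcal{C}}/\mathrm{Aff}(\mathbb{R}^d)$, and $\overline{\mathcal{V}}_{\mathcal{C}}^{+}\subseteq\overline{\mathcal{V}}_{\mathcal{C}}$ is the polyhedral cone of classes of convex functions. A CPWL function $f$ is identified with its class in $\mathrm{CPWL}_d/\mathrm{Aff}(\mathbb{R}^d)$, in which the identities below are understood. The decomposition polyhedron is $\mathcal{D}_{\mathcal{C}}(f)=\{(g,h)\mid g,h\in\overline{\mathcal{V}}_{\mathcal{C}}^{+},\ f=g-h\}$. A polyhedron in a finite-dimensional real vector space (here $\overline{\mathcal{V}}_{\mathcal{C}}\times\overline{\mathcal{V}}_{\mathcal{C}}$) is the solution set of finitely many affine inequalities (possibly empty). *)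

(* Defs.v *)
From HB Require Import structures.
From mathcomp Require Import all_boot all_order all_algebra.
From mathcomp Require Import generic_quotient ring_quotient.
From mathcomp Require Import boolp classical_sets functions cardinality reals.
From mathcomp Require Import convex.

Set Implicit Arguments.
Unset Strict Implicit.
Unset Printing Implicit Defensive.
Import Order.TTheory GRing.Theory Num.Theory.

Local Open Scope classical_set_scope.
Local Open Scope ring_scope.
Local Open Scope quotient_scope.

Section Polyhedra.
Variable R : realType.

(* Linearity of phi on a subspace V of E; its values outside V are irrelevant *)
Definition linear_on (E : lmodType R) (V : set E) (phi : E -> R) : Prop :=
  forall (a : R) (u v : E), V u -> V v -> phi (a *: u + v) = a * phi u + phi v.

(* P is a polyhedron in the subspace V of E *)
Definition polyhedron_in (E : lmodType R) (V P : set E) : Prop :=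
  exists (n : nat) (phi : 'I_n -> E -> R) (b : 'I_n -> R),
    (forall i, linear_on V (phi i)) /\
    P = [set x | V x /\ forall i, phi i x <= b i].

Variable d : nat.
Implicit Types (P Q F : set 'rV[R]_d) (C : set (set 'rV[R]_d)).

(* With a = 0 this makes P itself (b = 0) and the empty set (b = 1) faces of P *)
Definition face F P : Prop :=
  exists (a : {scalar 'rV[R]_d}) (b : R),
    (forall x, P x -> a x <= b) /\ F = P `&` [set x | a x = b].

(* x0 + U is the affine hull of P; the empty set has no dimension *)
Definition has_dim P (k : nat) : Prop :=
  exists (x0 : 'rV[R]_d) (U : {vspace 'rV[R]_d}),
    [/\ P x0, \dim U = k, forall x, P x -> x - x0 \in U &
        forall W : {vspace 'rV[R]_d},
          (forall x, P x -> x - x0 \in W) -> (U <= W)%VS].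

Record polyhedral_complex C : Prop := PolyhedralComplex {
  pc_finite : finite_set C;
  pc_polyhedron : forall P, C P -> polyhedron_in setT P;
  pc_set0 : C set0;
  pc_face : forall P F, C P -> face F P -> C F;
  pc_inter : forall P Q, C P -> C Q -> face (P `&` Q) P /\ face (P `&` Q) Q
}.

Definition pure_of_dim C (k : nat) : Prop :=
  forall P, C P -> (forall Q, C Q -> P `<=` Q -> Q = P) -> has_dim P k.

Definition complete C : Prop := \bigcup_(P in C) P = setT.

Record pure_complete_complex C : Prop := PureCompleteComplex {
  pcc_complex : polyhedral_complex C;
  pcc_pure : pure_of_dim C d;
  pcc_complete : complete C
}.

End Polyhedra.

Section Functions.
Variables (R : realType) (d : nat).

(* R^o, the library's alias of R as an R-module, makes rfun an R-module *)
Definition rfun : Type := 'rV[R]_d -> R^o.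
HB.instance Definition _ := GRing.Lmodule.on rfun.

Definition affine_fun (g : rfun) : Prop :=
  exists (a : {scalar 'rV[R]_d}) (b : R), g = (fun x => a x + b).

Definition affine_on (P : set 'rV[R]_d) (g : rfun) : Prop :=
  exists2 h : rfun, affine_fun h & forall x, P x -> g x = h x.

(* the space V_C of functions compatible with C *)
Definition compatible (C : set (set 'rV[R]_d)) : set rfun :=
  [set g | forall P, C P -> affine_on P g].

(* Continuity is automatic: the members of C are finitely many closed sets
   that cover the space. *)
Definition cpwl : set rfun :=
  [set g | exists2 C, pure_complete_complex C & compatible C g].

Definition Aff : {pred rfun} := fun g => `[< affine_fun g >].

Lemma Aff_submod_closed : submod_closed Aff.
Proof.
split.
  apply/asboolP; exists (\0 : {scalar 'rV[R]_d}), 0.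
  by apply/funext => x /=; rewrite addr0.
move=> c _ _ /asboolP[a1 [b1 ->]] /asboolP[a2 [b2 ->]]; apply/asboolP.
have lin : scalar (fun x => c * a1 x + a2 x).
  by move=> k x y; rewrite !linearP /= !mulrDr addrACA mulrCA.
pose a := GRing.isLinear.Build R 'rV[R]_d R^o *%R _ lin.
pose a' : {scalar 'rV[R]_d} := HB.pack (fun x => c * a1 x + a2 x) a.
exists a', (c * b1 + b2); apply/funext => x /=.
by rewrite [LHS]/(c * (a1 x + b1) + (a2 x + b2)) mulrDr addrACA.
Qed.

HB.instance Definition _ :=
  GRing.isSubmodClosed.Build R rfun Aff Aff_submod_closed.

(* All functions modulo affine ones: the common ambient space in which
   CPWL_d/Aff and V_C/Aff are the images of the subspaces CPWL_d and V_C.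
   The library makes it a zmodule; the R-module structure is added here. *)
Definition funmodAff : Type := Quotient.quot Aff.
HB.instance Definition _ := GRing.Zmodule.on funmodAff.
HB.instance Definition _ := EqQuotient.on funmodAff.

Definition cls (g : rfun) : funmodAff := \pi_(Quotient.quot Aff) g.

Lemma cls_surj (u : funmodAff) : exists g, u = cls g.
Proof. by exists (repr u); rewrite /cls reprK. Qed.

Lemma clsP (g h : rfun) : cls g = cls h <-> affine_fun (g - h).
Proof.
split=> [/eqP|gh]; first by rewrite /cls -Quotient.idealrBE => /asboolP.
by apply/eqP; rewrite /cls -Quotient.idealrBE; apply/asboolP.
Qed.

Lemma clsD (g h : rfun) : cls (g + h) = cls g + cls h.
Proof. exact: Quotient.pi_add. Qed.

Lemma clsN (g : rfun) : cls (- g) = - cls g.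
Proof. exact: Quotient.pi_opp. Qed.

Definition scale_cls (c : R) (u : funmodAff) : funmodAff := cls (c *: repr u).

Lemma scale_clsE c g : scale_cls c (cls g) = cls (c *: g).
Proof.
apply/clsP; rewrite -scalerBr; apply/asboolP; apply: (@rpredZ _ _ Aff).
by apply/asboolP/clsP; rewrite /cls reprK.
Qed.

Let scaleA a b u : scale_cls a (scale_cls b u) = scale_cls (a * b) u.
Proof. by have [g ->] := cls_surj u; rewrite !scale_clsE scalerA. Qed.

Let scale1 : left_id 1 scale_cls.
Proof. by move=> u; have [g ->] := cls_surj u; rewrite scale_clsE scale1r. Qed.

Let scaleDr : right_distributive scale_cls +%R.
Proof.
move=> a u v; have [g ->] := cls_surj u; have [h ->] := cls_surj v.
by rewrite -clsD !scale_clsE -clsD scalerDr.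
Qed.

Let scaleDl u : {morph scale_cls^~ u : a b / a + b}.
Proof.
by move=> a b; have [g ->] := cls_surj u; rewrite !scale_clsE -clsD scalerDl.
Qed.

HB.instance Definition _ := GRing.Zmodule_isLmodule.Build R funmodAff
  scaleA scale1 scaleDr scaleDl.

Lemma clsZ c (g : rfun) : cls (c *: g) = c *: cls g.
Proof. by rewrite -scale_clsE. Qed.

Definition CPWLbar : set funmodAff := cls @` cpwl.

Definition Vbar (C : set (set 'rV[R]_d)) : set funmodAff := cls @` compatible C.

Definition Vbarplus (C : set (set 'rV[R]_d)) : set funmodAff :=
  cls @` (compatible C `&` [set g | convex_function setT g]).

Lemma compatible_submod_closed C (a : R) (g h : rfun) :
  compatible C g -> compatible C h -> compatible C (a *: g + h).
Proof.
move=> Cg Ch P CP; have [g' g'a gE] := Cg P CP; have [h' h'a hE] := Ch P CP.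
exists (a *: g' + h').
  by apply/asboolP; apply: Aff_submod_closed.2; apply/asboolP.
move=> x Px; rewrite [LHS]/(a *: g x + h x) [RHS]/(a *: g' x + h' x).
by rewrite gE// hE.
Qed.

Lemma Vbar0 C : Vbar C 0.
Proof.
exists 0; last by rewrite -(subrr 0) clsD clsN subrr.
by move=> P _; exists 0 => //; apply/asboolP; exact: Aff_submod_closed.1.
Qed.

Lemma Vbar_submod_closed C (a : R) (u v : funmodAff) :
  Vbar C u -> Vbar C v -> Vbar C (a *: u + v).
Proof.
move=> [g Cg <-] [h Ch <-]; exists (a *: g + h); last by rewrite clsD clsZ.
exact: compatible_submod_closed.
Qed.

Definition decomposition_polyhedron (C : set (set 'rV[R]_d)) (f : rfun) :
    set (funmodAff * funmodAff) :=
  [set p | [/\ Vbarplus C p.1, Vbarplus C p.2 & cls f = p.1 - p.2]].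

Definition Hf (f : rfun) : set (funmodAff * funmodAff) :=
  [set p | [/\ CPWLbar p.1, CPWLbar p.2 & cls f = p.1 - p.2]].

End Functions.

(* Main.v *)
Require Import Defs.
From HB Require Import structures.
From mathcomp Require Import all_boot all_order all_algebra.
From mathcomp Require Import boolp classical_sets cardinality reals.
From mathcomp Require Import convex interval_inference ring lra.

Import Order.TTheory GRing.Theory Num.Theory.
Local Open Scope classical_set_scope.
Local Open Scope ring_scope.

(** The identity with [Hf], the injectivity of the projection and the formula
for its image are formal: the second component of a pair in the decomposition
polyhedron is determined by the first, as [h = g - f].  The content is that the
set is cut out by finitely many linear inequalities, and this reduces to the
same claim for the cone [Vbarplus C] of classes of convex compatible functions.
Indeed that cone is pointed ([Vbarplus_pointed]), so the equation [g - h = f]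
says that both [g - h - f] and [h - g + f] lie in the cone; if [f] has no class
in [Vbar C] there is no decomposition at all.

To describe the convex functions among the compatible ones, let [P] be a cell
of full dimension.  A compatible [g] agrees on [P] with one affine function,
the affine extension [g_P], which depends linearly on [g].  A convex [g]
dominates [g_P] everywhere, because [P] has an inner point; conversely, if [g]
dominates all the [g_P], it is their maximum since the full cells cover the
space, hence it is convex ([convex_iff_ge_affine_extensions]).  So [g] is convex
exactly when, for each of the finitely many pairs [P], [Q] of full cells, the
affine function [g_Q - g_P] is nonnegative on [Q].

Nonnegativity of an affine function on a polyhedron [Q] is in turn finitely many
linear inequalities ([nonneg_affine_polyhedron]): the homogenization cone over
[Q] is the solution set of finitely many homogeneous inequalities, so by the
Minkowski half of the Minkowski-Weyl theorem it has finitely many generators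
([finitely_generated_polyhedral]), and it suffices to test those.

Finally the description descends to the quotient by affine functions, because
a linear functional bounded above on the space of affine functions vanishes on
it ([polyhedron_in_Vbar]). *)

(** * Closure properties of polyhedra in a subspace *)

Section PolyhedronIn.
Context {R : realType}.
Implicit Types E : lmodType R.

Lemma linear_onT_scalar {E} (phi : E -> R) :
  linear_on setT phi -> exists psi : {scalar E}, phi = psi.
Proof.
move=> lphi; have lin : scalar (phi : E -> R^o) by move=> a u v; exact: lphi.
pose m := GRing.isLinear.Build R E R^o *%R _ lin.
pose psi : {scalar E} := HB.pack (phi : E -> R^o) m.
by exists psi.
Qed.

Lemma polyhedron_in_finType {E} {V : set E} {I : finType} (phi : I -> E -> R)
    (b : I -> R) : (forall i, linear_on V (phi i)) ->
  polyhedron_in V [set x | V x /\ forall i, phi i x <= b i].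
Proof.
move=> lphi; exists #|I|, (phi \o enum_val), (b \o enum_val); split=> [i|].
  exact: lphi.
apply/seteqP; split=> x [Vx xP]; split=> // i; first exact: xP.
by have := xP (enum_rank i); rewrite /= enum_rankK.
Qed.

Lemma polyhedron_inT {E} (V : set E) : polyhedron_in V V.
Proof.
suff -> : polyhedron_in V V =
    polyhedron_in V [set x | V x /\ forall i : void, (fun=> 0) x <= 0 :> R].
  apply: (@polyhedron_in_finType _ V void (fun _ => fun=> 0) (fun=> 0)).
  by case.
by congr polyhedron_in; apply/seteqP; split=> [x Vx|x []//]; split=> // -[].
Qed.

Lemma polyhedron_in0 {E} (V : set E) : polyhedron_in V set0.
Proof.
have -> : set0 =
    [set x | V x /\ forall i : unit, (fun=> 0) x <= -1 :> R] :> set E.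
  by apply/seteqP; split=> // x [_ /(_ tt)] /=; rewrite oppr_ge0 ler10.
apply: (@polyhedron_in_finType _ V unit (fun _ => fun=> 0) (fun=> -1)).
by move=> _ a u v _ _; rewrite mulr0 addr0.
Qed.

Lemma polyhedron_inI {E} {V P Q : set E} :
  polyhedron_in V P -> polyhedron_in V Q -> polyhedron_in V (P `&` Q).
Proof.
move=> [n [phi [b [lphi ->]]]] [m [psi [c [lpsi ->]]]].
pose chi (i : 'I_n + 'I_m) := match i with inl i => phi i | inr j => psi j end.
pose e (i : 'I_n + 'I_m) := match i with inl i => b i | inr j => c j end.
have -> : [set x | V x /\ forall i, phi i x <= b i] `&`
    [set x | V x /\ forall i, psi i x <= c i] =
    [set x | V x /\ forall i, chi i x <= e i].
  apply/seteqP; split=> x.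
    by move=> [[Vx xP] [_ xQ]]; split=> // -[].
  move=> [Vx h]; split; split=> // i; first exact: (h (inl i)).
  exact: (h (inr i)).
by apply: polyhedron_in_finType; case.
Qed.

Lemma polyhedron_in_cap {E} (T : eqType) {V : set E} {I : set T}
    {A : T -> set E} : finite_set I ->
    (forall i, I i -> polyhedron_in V (V `&` A i)) ->
  polyhedron_in V [set x | V x /\ forall i, I i -> A i x].
Proof.
move=> /finite_seqP[s ->]; elim: s => [|i s IHs] hA.
  rewrite (_ : [set x | _] = V); first exact: polyhedron_inT.
  by apply/seteqP; split=> [x []//|x Vx]; split=> // i; rewrite /= in_nil.
rewrite (_ : [set x | _] = (V `&` A i) `&`
    [set x | V x /\ forall i, [set` s] i -> A i x]).
  apply: polyhedron_inI; first by apply: hA; rewrite /= mem_head.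
  by apply: IHs => j sj; apply: hA; rewrite /= in_cons; apply/orP; right.
apply/seteqP; split=> [x [Vx h]|x [[Vx Ax] [_ h]]].
  split; first by split=> //; apply: h; rewrite /= mem_head.
  by split=> // j sj; apply: h; rewrite /= in_cons; apply/orP; right.
by split=> // j; rewrite /= in_cons => /predU1P[->//|]; exact: h.
Qed.

(** The substitution of an affine map [L + w] into an affine inequality is again
an affine inequality: the value of the functional at [w] moves to the bound. *)
Lemma polyhedron_in_preimage (E E' : lmodType R) (W : set E) (V P : set E')
    (L : E -> E') (w : E') :
    (forall (a : R) u v, V u -> V v -> V (a *: u + v)) ->
    (forall (a : R) u v, W u -> W v -> L (a *: u + v) = a *: L u + L v) ->
    (forall x, W x -> V (L x)) -> V w -> polyhedron_in V P ->
  polyhedron_in W [set x | W x /\ P (L x + w)].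
Proof.
move=> Vlin Llin LV Vw [n [phi [b [lphi ->]]]].
exists n, (fun i => phi i \o L), (fun i => b i - phi i w); split.
  by move=> i a u v Wu Wv /=; rewrite Llin// lphi//; exact: LV.
have phiD i x : W x -> phi i (L x + w) = phi i (L x) + phi i w.
  by move=> Wx; rewrite -[L x]scale1r lphi// ?mul1r ?scale1r//; exact: LV.
apply/seteqP; split=> x [Wx].
  by move=> [_ h]; split=> // i; rewrite /= lerBrDr -phiD.
move=> h; split=> //; split=> [|i]; last by rewrite phiD// -lerBrDr; exact: h.
by rewrite -[L x]scale1r; apply: Vlin => //; exact: LV.
Qed.

End PolyhedronIn.

(** * Finitely generated cones *)

Section Cones.
Context {R : realType}.
Implicit Types E : lmodType R.

Definition cone {E} {I : finType} (g : I -> E) : set E :=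
  [set x | exists2 l : I -> R, (forall i, 0 <= l i) & x = \sum_i l i *: g i].

Definition finitely_generated {E} (K : set E) : Prop :=
  exists (I : finType) (g : I -> E), K = cone g.

Lemma cone0 {E} {I : finType} (g : I -> E) : cone g 0.
Proof. by exists (fun=> 0) => //; rewrite big1// => i _; rewrite scale0r. Qed.

Lemma coneD {E} {I : finType} (g : I -> E) x y :
  cone g x -> cone g y -> cone g (x + y).
Proof.
move=> [l l0 ->] [m m0 ->]; exists (fun i => l i + m i).
  by move=> i; rewrite addr_ge0.
by rewrite -big_split; apply: eq_bigr => i _; rewrite scalerDl.
Qed.

Lemma coneZ {E} {I : finType} (g : I -> E) a x :
  0 <= a -> cone g x -> cone g (a *: x).
Proof.
move=> a0 [l l0 ->]; exists (fun i => a * l i) => [i|]; first exact: mulr_ge0.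
by rewrite scaler_sumr; apply: eq_bigr => i _; rewrite scalerA.
Qed.

Lemma cone_sum {E} {I : finType} (g : I -> E) {J : finType} {P : pred J}
    (F : J -> E) :
  (forall j, P j -> cone g (F j)) -> cone g (\sum_(j | P j) F j).
Proof.
by move=> gF; apply: big_ind => //; [exact: cone0|move=> x y; exact: coneD].
Qed.

Lemma cone_generator {E} {I : finType} (g : I -> E) i : cone g (g i).
Proof.
exists (fun j => (j == i)%:R) => [j|]; first exact: ler0n.
rewrite (bigD1 i)//= eqxx scale1r big1 ?addr0// => j /negPf->.
by rewrite scale0r.
Qed.

Lemma finitely_generatedT (E : vectType R) : finitely_generated [set: E].
Proof.
pose e (i : 'I_(\dim {:E})) := (vbasis {:E})`_i.
exists (bool * 'I_(\dim {:E}))%type.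
exists (fun p : bool * 'I_(\dim {:E}) => (-1) ^+ p.1 *: e p.2).
apply/seteqP; split=> // x _; rewrite (coord_vbasis (memvf x)).
apply: cone_sum => i _; set c := coord _ _ _.
rewrite [c]numEsign -mulrC -scalerA; apply: coneZ => //.
exact: (cone_generator _ (c < 0, i)).
Qed.

(** One step of the double description method.  Generators on the good side of
the hyperplane [psi = 0] are kept, and each generator [g i] on the bad side is
combined with each [g j] on the good side into a vector of the hyperplane.
Write a point of the cut cone as [X + Y], the bad and the good parts of a
combination, and let [P] and [N] be the values of [psi] on [X] and of [- psi]
on [Y].  Then [P <= N], so that [X + Y] is the sum of a combination of the new
vectors, [X + (P / N) *: Y], and of the leftover [(1 - P / N) *: Y]. *)
Lemma finitely_generated_halfspace {E} {K : set E} (psi : {scalar E}) :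
  finitely_generated K -> finitely_generated (K `&` [set x | psi x <= 0]).
Proof.
move=> [I [g ->]]; pose a i : R := psi (g i).
(* Combinations that are not required are set to 0, which is harmless, so that
   the new family is indexed by a plain finite type. *)
pose g' (k : I + I * I) : E := match k with
  | inl i => if a i <= 0 then g i else 0
  | inr (i, j) => if (0 < a i) && (a j <= 0) then a i *: g j - a j *: g i else 0
  end.
exists (I + I * I)%type, g'; apply/seteqP; split=> [x [[l l0 ->]]|x].
  rewrite /= linear_sum/= => psi_le0.
  pose P := \sum_(i | 0 < a i) l i * a i.
  pose N := \sum_(j | ~~ (0 < a j)) l j * - a j.
  pose X := \sum_(i | 0 < a i) l i *: g i.
  pose Y := \sum_(j | ~~ (0 < a j)) l j *: g j.
  have PN : P <= N.
    rewrite -subr_le0 /N; under [X in _ - X]eq_bigr do rewrite mulrN.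
    rewrite sumrN opprK; apply: le_trans psi_le0.
    rewrite [leRHS](bigID (fun i => 0 < a i))/=.
    by under [X in _ <= X + _]eq_bigr do rewrite linearZ;
       under [X in _ <= _ + X]eq_bigr do rewrite linearZ.
  have P0 : 0 <= P by apply: sumr_ge0 => i /ltW ?; exact: mulr_ge0.
  have Yg' : cone g' Y.
    apply: cone_sum => j; rewrite -leNgt => aj; apply: coneZ => //.
    by have := cone_generator g' (inl j); rewrite /= aj.
  rewrite (bigID (fun i => 0 < a i))/= -/X -/Y.
  (* For N = 0 the ratio P / N makes no sense, but then X = 0. *)
  have [N0|N0] := eqVneq N 0.
    have {}P0 : P = 0 by apply: le_anti; rewrite P0 -N0 PN.
    rewrite (_ : X = 0) ?add0r//; apply: big1 => i ai.
    move/eqP: P0; rewrite psumr_eq0 => [|j /ltW ?]; last exact: mulr_ge0.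
    move=> /allP/(_ i); rewrite mem_index_enum ai mulf_eq0 (gt_eqF ai) orbF.
    by move=> /(_ isT)/eqP->; rewrite scale0r.
  have Ngt0 : 0 < N by rewrite lt_def N0 (le_trans P0 PN).
  pose Z := \sum_(i | 0 < a i) \sum_(j | ~~ (0 < a j))
    (l i * l j) *: (a i *: g j - a j *: g i).
  have ZE : Z = P *: Y + N *: X.
    rewrite /P /Y scaler_suml /X scaler_sumr -big_split/=.
    apply: eq_bigr => i ai.
    rewrite scaler_sumr /N scaler_suml -big_split/=; apply: eq_bigr => j aj.
    rewrite scalerBr !scalerA -scaleNr; congr (_ *: _ + _ *: _); ring.
  have -> : X + Y = N^-1 *: Z + (1 - P / N) *: Y.
    rewrite ZE scalerDr !scalerA mulVf// scale1r scalerBl scale1r.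
    by rewrite [N^-1 * P]mulrC [_ + X]addrC addrACA subrr addr0.
  apply: coneD; apply: coneZ => //.
  - by rewrite invr_ge0 ltW.
  - apply: cone_sum => i ai; apply: cone_sum => j aj; apply: coneZ.
      exact: mulr_ge0.
    by have := cone_generator g' (inr (i, j)); rewrite /= ai leNgt aj.
  - by rewrite subr_ge0 ler_pdivrMr// mul1r.
have g'P k : cone g (g' k) /\ psi (g' k) <= 0.
  case: k => [i|[i j]] /=; case: ifP; rewrite ?linear0;
    try by split=> //; exact: cone0.
    by split=> //; exact: cone_generator.
  case/andP=> ai aj; split.
    rewrite -scaleNr; apply: coneD; apply: coneZ; rewrite ?oppr_ge0//;
      by [exact: ltW | exact: cone_generator].
  by rewrite linearB !linearZ/= -/(a i) -/(a j) [a j * _]mulrC subrr.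
move=> [l l0 ->]; split.
  by apply: cone_sum => k _; apply: coneZ => //; have [] := g'P k.
rewrite /= linear_sum/=; apply: sumr_le0 => k _; rewrite linearZ/=.
by apply: mulr_ge0_le0 => //; have [] := g'P k.
Qed.

(** Minkowski's theorem: start from the whole space, generated by the vectors of
a basis and their opposites, and cut by one half-space after the other. *)
Lemma finitely_generated_polyhedral {E : vectType R} {n : nat}
    (psi : 'I_n -> {scalar E}) :
  finitely_generated [set x | forall i, psi i x <= 0].
Proof.
elim: n psi => [|n IHn] psi.
  rewrite (_ : [set x | _] = setT); first exact: finitely_generatedT.
  by apply/seteqP; split=> // x _ [].
rewrite (_ : [set x | _] = [set x | forall i, psi (lift ord0 i) x <= 0]
    `&` [set x | psi ord0 x <= 0]).
  exact/finitely_generated_halfspace/IHn.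
apply/seteqP; split=> x; first by move=> h; split=> [i|]; exact: h.
by move=> [h h0] i; case: (unliftP ord0 i) => [j|] ->.
Qed.

End Cones.

(** * Affine functions on polyhedra *)

Section AffineFunctions.
Context {R : realType} {d : nat}.
Implicit Types (P Q : set 'rV[R]_d) (g h k : rfun R d).

(** For [k x = a x + c] this is [(y, t) |-> a y + c t], the linear form on pairs
that restricts to [k] at height [t = 1]. *)
Definition homogenization k (z : 'rV[R]_d * R^o) : R :=
  k z.1 - k 0 + k 0 * z.2.

Lemma affine_funP (a : R) h k :
  affine_fun h -> affine_fun k -> affine_fun (a *: h + k).
Proof.
by move=> hA kA; apply/asboolP; apply: (Aff_submod_closed R d).2; apply/asboolP.
Qed.

Lemma affine_fun0 : affine_fun (0 : rfun R d).
Proof. by apply/asboolP; exact: (Aff_submod_closed R d).1. Qed.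

Lemma linear_snd (c : R) (u v : 'rV[R]_d * R^o) :
  (c *: u + v).2 = c * u.2 + v.2 :> R.
Proof. by []. Qed.

(** [Q] is the slice at height 1 of the cone of the pairs [(y, t)] with [t >= 0]
that satisfy the homogenized inequalities of [Q].  For a nonempty [Q], an affine
function is nonnegative on [Q] iff its homogenization is nonnegative on this
cone, that is, on the finitely many generators of the cone. *)
Lemma nonneg_affine_polyhedron Q : polyhedron_in setT Q ->
  polyhedron_in (@affine_fun R d)
    [set k | affine_fun k /\ forall x, Q x -> 0 <= k x].
Proof.
have [->|/set0P[q Qq]] := eqVneq Q set0.
  move=> _; rewrite (_ : [set k | _] = @affine_fun R d).
    exact: polyhedron_inT.
  by apply/seteqP; split=> k // [].
move=> [n [phi [b [lphi QE]]]].
have /choice[psi phiE] : forall i, exists psi : {scalar 'rV[R]_d}, phi i = psi.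
  by move=> i; exact/linear_onT_scalar/lphi.
have /choice[chi chiE] : forall i, exists chi : {scalar ('rV[R]_d * R^o)%type},
    forall z, chi z = psi i z.1 - z.2 * b i.
  move=> i; have [|f fE] := @linear_onT_scalar R ('rV[R]_d * R^o)%type
    (fun z => psi i z.1 - z.2 * b i).
    by move=> c u v _ _; rewrite linear_snd linearP/=; ring.
  by exists f => z; rewrite -fE.
have [tau tauE] : exists tau : {scalar ('rV[R]_d * R^o)%type},
    forall z, tau z = - z.2.
  have [|f fE] := @linear_onT_scalar R ('rV[R]_d * R^o)%type (fun z => - z.2).
    by move=> c u v _ _; rewrite linear_snd; ring.
  by exists f => z; rewrite -fE.
have [I [g KE]] := finitely_generated_halfspace tau
  (finitely_generated_polyhedral chi).
rewrite (_ : [set k | _] = [set k | affine_fun k /\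
    forall i, - homogenization k (g i) <= 0]).
  apply: polyhedron_in_finType => i c h k _ _; rewrite /homogenization.
  have E x : (c *: h + k) x = c * h x + k x by [].
  by rewrite !E; ring.
apply/seteqP; split=> k [[a [c kE]] k_ge0]; split; try by exists a, c.
  move=> i; have : cone g (g i) by exact: cone_generator.
  rewrite -KE /homogenization kE /=; case: (g i) => y t [/= yK]; rewrite tauE/=.
  rewrite linear0 oppr_le0 oppr_le0 => t_ge0.
  have {}yK j : psi j y <= t * b j.
    by have := yK j; rewrite chiE /= subr_le0.
  (* At height 0 the vector y is a recession direction of Q, along which a
     function that is bounded below cannot decrease: at the point below, k would
     take the value -1. *)
  have [t0|t0] := eqVneq t 0.
    rewrite t0 leNgt; apply/negP => ay.
    have {}ay : a y < 0 by lra.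
    have kq : 0 <= k q by exact: k_ge0.
    have : 0 <= k (((k q + 1) / - a y) *: y + q).
      apply: k_ge0; rewrite QE; split=> // j; rewrite phiE linearP/=.
      rewrite -[b j]add0r; apply: lerD.
        apply: mulr_ge0_le0; first by apply: divr_ge0; lra.
        by have := yK j; rewrite t0 mul0r.
      by move: Qq; rewrite QE => -[_ /(_ j)]; rewrite phiE.
    rewrite kE linearP/= invrN mulrN mulNr divfK ?lt_eqF//.
    by move: kq; rewrite kE; lra.
  have t_gt0 : 0 < t by rewrite lt_def t0.
  have : 0 <= k (t^-1 *: y).
    apply: k_ge0; rewrite QE; split=> // j; rewrite phiE linearZ/= mulrC.
    by rewrite ler_pdivrMr// mulrC.
  rewrite kE linearZ/= => /(mulr_ge0 t_ge0).
  by rewrite mulrDr mulrA mulfV// mul1r; lra.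
move=> x Qx; have : cone g (x, 1).
  rewrite -KE; split=> /=; last by rewrite tauE /= lerN10.
  move=> j; rewrite chiE/= mul1r subr_le0.
  by move: Qx; rewrite QE -phiE => -[_].
move=> [l l_ge0 xE].
have -> : k x = \sum_i l i * homogenization k (g i).
  transitivity (homogenization k (x, 1)).
    by rewrite /homogenization mulr1 subrK.
  have [|H HE] := @linear_onT_scalar R ('rV[R]_d * R^o)%type (homogenization k).
    move=> s u v _ _; rewrite /homogenization kE linear_snd linearP/=.
    by ring.
  by rewrite HE xE linear_sum; apply: eq_bigr => i _; rewrite linearZ.
by apply: sumr_ge0 => i _; apply: mulr_ge0 => //; rewrite -oppr_le0.
Qed.

(** The points where the linear parts of [h] and [k] agree form a subspace,
which contains all differences of points of [P], hence is the whole space. *)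
Lemma affine_fun_eq P h k : has_dim P d -> affine_fun h -> affine_fun k ->
  (forall x, P x -> h x = k x) -> h = k.
Proof.
move=> [x0 [U [Px0 dimU _ Umin]]] [a [b hE]] [a' [b' kE]] hk.
pose D := linfun ((a : 'rV[R]_d -> R^o) \- a').
have DE v : D v = a v - a' v :> R by rewrite lfunE.
have kerT v : v \in lker D.
  have /subvP : (U <= lker D)%VS.
    apply: Umin => x Px; rewrite memv_ker DE.
    have := hk _ Px; have := hk _ Px0; rewrite hE kE/= => e1 e2.
    have ax : a (x - x0) = a x - a x0 :> R by rewrite linearB.
    have a'x : a' (x - x0) = a' x - a' x0 :> R by rewrite linearB.
    by rewrite ax a'x; apply/eqP; lra.
  apply; suff -> : U = fullv by exact: memvf.
  apply/eqP; rewrite eqEdim subvf dimvf dim_matrix dimU.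
  by rewrite [(1 * d)%R]mul1n leqnn.
have aE v : a v = a' v.
  by have := kerT v; rewrite memv_ker DE subr_eq0 => /eqP.
rewrite hE kE; apply/funext => x; rewrite aE; congr (_ + _).
by have := hk _ Px0; rewrite hE kE/= aE => /addrI.
Qed.

Definition affine_extension P g : rfun R d :=
  xget 0 [set h | affine_fun h /\ forall x, P x -> g x = h x].

Lemma affine_extensionP P g : affine_on P g ->
  affine_fun (affine_extension P g) /\
  forall x, P x -> g x = affine_extension P g x.
Proof.
move=> [h ah gh].
by apply: (@xgetPex _ 0 [set h | affine_fun h /\ _]); exists h.
Qed.

Lemma affine_extension_unique P g h : has_dim P d -> affine_fun h ->
  (forall x, P x -> g x = h x) -> affine_extension P g = h.
Proof.
move=> dP ah gh; have [|ae ge] := @affine_extensionP P g; first by exists h.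
by apply: (affine_fun_eq P) => // x Px; rewrite -ge// gh.
Qed.

Lemma affine_extension_linear P (a : R) g h : has_dim P d ->
  affine_on P g -> affine_on P h ->
  affine_extension P (a *: g + h) =
    a *: affine_extension P g + affine_extension P h.
Proof.
move=> dP /affine_extensionP[ag gE] /affine_extensionP[ah hE].
apply: affine_extension_unique => //; first exact: affine_funP.
by move=> x Px; rewrite [LHS]/(a * g x + h x) gE// hE.
Qed.

End AffineFunctions.

(** * Convexity of compatible functions *)

Section Convexity.
Context {R : realType} {d : nat}.
Implicit Types (P Q : set 'rV[R]_d) (C : set (set 'rV[R]_d)) (g h k : rfun R d).

Lemma convex_functionP g : convex_function setT g <->
  forall t x y, 0 <= t -> t <= 1 ->
    g (t *: x + (1 - t) *: y) <= t * g x + (1 - t) * g y.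
Proof.
split=> [gconv t x y t0 t1|gconv t x y _ _].
  by have := gconv (Itv01 t0 t1) x y; rewrite !inE; apply.
exact: gconv.
Qed.

(** Each inequality of [P] is either strict somewhere on [P] or trivial, since
its functional would otherwise be constant on a set of full dimension.  By
midpoints, one point [p] makes all nontrivial inequalities strict, and from
there one can move a little in every direction, in particular away from [x]. *)
Lemma polyhedron_inner_point P x : has_dim P d -> polyhedron_in setT P ->
  exists p e, [/\ 0 < e, P p & P (p + e *: (p - x))].
Proof.
move=> dP [n [phi [b [lphi PE]]]].
have /choice[psi phiE] : forall i, exists psi : {scalar 'rV[R]_d}, phi i = psi.
  by move=> i; exact/linear_onT_scalar/lphi.
have {}PE y : P y <-> forall i, psi i y <= b i.
  rewrite PE; split=> [[_ h] i|h]; first by rewrite -phiE.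
  by split=> // i; rewrite phiE.
have strict i : (exists2 p, P p & psi i p < b i) \/ forall y, psi i y = 0.
  have [|nP] := pselect (exists2 p, P p & psi i p < b i); [by left|right].
  have aff0 : affine_fun ((fun=> b i) : rfun R d).
    by exists \0, (b i); apply/funext => y; rewrite add0r.
  have affi : affine_fun (psi i : rfun R d).
    by exists (psi i), 0; apply/funext => y; rewrite addr0.
  have psiE : (psi i : rfun R d) = (fun=> b i).
    apply: (affine_fun_eq P) => // y Py; apply/eqP; rewrite eq_le.
    by have /PE -> := Py; rewrite leNgt; apply/negP => ?; apply: nP; exists y.
  have b0 : b i = 0.
    by have := congr1 (fun f : rfun R d => f 0) psiE; rewrite /= linear0.
  by move=> y; have := congr1 (fun f : rfun R d => f y) psiE; rewrite /= b0.
have [p Pp p_strict] : exists2 p, P p & forall i, i \in enum 'I_n ->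
    psi i p < b i \/ forall y, psi i y = 0.
  elim: (enum 'I_n) => [|i s [p Pp IHs]].
    by have [p [_ [Pp _ _ _]]] := dP; exists p.
  have [[q Pq qi]|psi0] := strict i; last first.
    by exists p => // j; rewrite in_cons => /predU1P[->|/IHs//]; right.
  exists (2^-1 *: p + 2^-1 *: q).
    apply/PE => j; rewrite linearD !linearZ/=.
    by have /PE/(_ j) := Pp; have /PE/(_ j) := Pq; lra.
  move=> j; rewrite in_cons => /predU1P[->|/IHs[pj|]]; [left|left|by right].
    by rewrite linearD !linearZ/=; have /PE/(_ i) := Pp; lra.
  by rewrite linearD !linearZ/=; have /PE/(_ j) := Pq; lra.
(* The length that may be travelled before the i-th inequality is violated;
   when there is no such bound, 1 is an arbitrary positive value. *)
pose e i : R :=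
  if 0 < psi i (p - x) then (b i - psi i p) / psi i (p - x) else 1.
have e_gt0 i : 0 < e i.
  rewrite /e; case: ifPn => // px; apply: divr_gt0 => //.
  have [|pi|p0] := p_strict i; first by rewrite mem_enum.
    by rewrite subr_gt0.
  by move: px; rewrite p0 ltxx.
have m_gt0 : 0 < \big[Num.min/1]_i e i by apply: lt_bigmin.
exists p, (\big[Num.min/1]_i e i); split=> //.
apply/PE => i; rewrite linearD linearZ/= -lerBrDl.
have : \big[Num.min/1]_i e i <= e i by exact: bigmin_le.
rewrite {2}/e; case: ifPn => [px|]; first by rewrite ler_pdivlMr.
rewrite -leNgt => px _; apply: (@le_trans _ _ 0).
  by apply: mulr_ge0_le0 => //; exact: ltW.
by rewrite subr_ge0; have /PE := Pp.
Qed.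

(** The inner point [p] lies between [x] and a point [q] of [P]; as [g]
is affine between [p] and [q], convexity on the segment from [x] to [q] puts
[g x] above the line through the values at [p] and [q]. *)
Lemma convex_ge_affine_extension P g x : has_dim P d -> polyhedron_in setT P ->
  affine_on P g -> convex_function setT g -> affine_extension P g x <= g x.
Proof.
move=> dP polP gP /convex_functionP gconv.
have [p [e [e0 Pp Pq]]] := polyhedron_inner_point P x dP polP.
have [[a [b hE]] gh] := affine_extensionP P g gP.
have e1 : 0 < 1 + e by rewrite addr_gt0.
have t0 : 0 <= e / (1 + e) by apply: divr_ge0; exact: ltW.
have t1 : e / (1 + e) <= 1 by rewrite ler_pdivrMr// mul1r lerDr.
have tE : 1 - e / (1 + e) = (1 + e)^-1 by field; rewrite gt_eqF.
have := gconv _ x (p + e *: (p - x)) t0 t1.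
have -> : (e / (1 + e)) *: x + (1 - e / (1 + e)) *: (p + e *: (p - x)) = p.
  rewrite tE [e / _]mulrC -scalerA -scalerDr scalerBr addrCA.
  rewrite [_ *: x + _]addrC subrK -{1}[p]scale1r -scalerDl scalerA.
  by rewrite mulVf ?scale1r// gt_eqF.
have aE : a (p + e *: (p - x)) = a p + e * (a p - a x).
  by rewrite linearD linearZ linearB.
rewrite tE (gh _ Pp) (gh _ Pq) hE aE -(ler_pM2l e1).
set z := a p + e * _ + b.
have -> : (1 + e) * (e / (1 + e) * g x + (1 + e)^-1 * z) = e * g x + z.
  by field; rewrite gt_eqF.
rewrite /z => le_e; rewrite -(ler_pM2l e0); lra.
Qed.

Lemma sub_maximal_member (s : seq (set 'rV[R]_d)) P : P \in s ->
  exists Q, [/\ Q \in s, P `<=` Q &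
    forall Q', Q' \in s -> Q `<=` Q' -> Q' = Q].
Proof.
suff H : exists Q, [/\ Q = P \/ Q \in s, P `<=` Q &
    forall Q', Q' \in s -> Q `<=` Q' -> Q' = Q].
  by move=> sP; have [Q [[->|Qs] PQ Qmax]] := H; [exists P|exists Q].
elim: s => [|A s [Q [Qs PQ Qmax]]]; first by exists P; split=> //; left.
have [QA|nQA] := pselect (Q `<=` A); last first.
  exists Q; split=> // [|Q'].
    by case: Qs => [|Qs]; [left|right]; rewrite // in_cons Qs orbT.
  by rewrite in_cons => /predU1P[->//|]; exact: Qmax.
exists A; split; first by right; rewrite mem_head.
  exact: subset_trans QA.
move=> Q'; rewrite in_cons => /predU1P[//|Q's] AQ'.
have Q'Q : Q' = Q by apply: Qmax => //; exact: subset_trans AQ'.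
by apply/seteqP; split=> //; rewrite Q'Q.
Qed.

Section Complex.
Context {C : set (set 'rV[R]_d)}.
Context (CC : pure_complete_complex C).

Local Definition full_cell : set (set 'rV[R]_d) :=
  [set P | C P /\ has_dim P d].

Lemma finite_full_cell : finite_set full_cell.
Proof.
rewrite (_ : full_cell = C `&` [set P | has_dim P d])//.
by apply: finite_setIl; exact: pc_finite (pcc_complex CC).
Qed.

(** Every cell lies in a maximal one, which has full dimension by purity. *)
Lemma full_cell_cover x : exists2 P, full_cell P & P x.
Proof.
have /finite_seqP[s Cs] := pc_finite (pcc_complex CC).
have [P CP Px] : (\bigcup_(P in C) P) x by rewrite (pcc_complete CC).
have sP : P \in s by move: CP; rewrite Cs.
have [Q [sQ PQ Qmax]] := sub_maximal_member s P sP.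
have CQ : C Q by rewrite Cs.
exists Q; last exact: PQ.
split=> //; apply: (pcc_pure CC) => // Q' CQ'; apply: Qmax.
by move: CQ'; rewrite Cs.
Qed.

(** The right-hand side makes [g] the maximum of its affine extensions: it
dominates them all, and it equals one of them at each point. *)
Lemma convex_iff_ge_affine_extensions g : compatible C g ->
  convex_function setT g <->
    forall P, full_cell P -> forall x, affine_extension P g x <= g x.
Proof.
move=> Cg; split=> [gconv P [CP dP] x|g_ge].
  apply: convex_ge_affine_extension => //; last exact: Cg.
  exact: pc_polyhedron (pcc_complex CC) _ CP.
apply/convex_functionP => t x y t0 t1.
have [P PC Pz] := full_cell_cover (t *: x + (1 - t) *: y).
have [[a [b hE]] gh] := affine_extensionP P g (Cg P PC.1).
have := g_ge P PC x; have := g_ge P PC y.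
rewrite (gh _ Pz) hE linearD !linearZ/= => gy gx.
have := ler_wpM2l t0 gx; have : 0 <= 1 - t by rewrite subr_ge0.
by move=> /ler_wpM2l /(_ _ _ gy); lra.
Qed.

(** On a full cell [Q], a compatible [g] is its own affine extension, so that
domination of the extension from [P] at the points of [Q] is nonnegativity on
[Q] of an affine function that depends linearly on [g].  Since the full cells
[Q] cover the space, this yields domination everywhere. *)
Lemma compatible_convex_polyhedron :
  polyhedron_in (compatible C)
    (compatible C `&` [set g | convex_function setT g]).
Proof.
rewrite (_ : _ `&` _ = [set g | compatible C g /\ forall PQ,
    (full_cell `*` full_cell) PQ ->
    forall x, PQ.2 x -> affine_extension PQ.1 g x <= g x]).
  apply: polyhedron_in_cap.
    by apply: finite_setX; exact: finite_full_cell.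
  move=> [P Q] [/= [CP dP] [CQ dQ]].
  pose L g := affine_extension Q g - affine_extension P g.
  have L_affine g : compatible C g -> affine_fun (L g).
    move=> Cg; rewrite /L addrC -scaleN1r; apply: affine_funP.
      by have [] := affine_extensionP P g (Cg P CP).
    by have [] := affine_extensionP Q g (Cg Q CQ).
  have L_ge0 g x : compatible C g -> Q x ->
      (0 <= (L g + 0) x) = (affine_extension P g x <= g x).
    move=> Cg Qx; rewrite addr0.
    rewrite [X in 0 <= X]/(affine_extension Q g x - affine_extension P g x).
    by have [_ <-//] := affine_extensionP Q g (Cg Q CQ); rewrite subr_ge0.
  rewrite (_ : _ `&` _ = [set g | compatible C g /\
      [set k | affine_fun k /\ forall x, Q x -> 0 <= k x] (L g + 0)]).
    apply: (polyhedron_in_preimage _ _ _ (@affine_fun R d)) => //.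
    - by move=> a g h; exact: affine_funP.
    - move=> a g h Cg Ch; rewrite /L.
      rewrite (affine_extension_linear Q)// ?(affine_extension_linear P)//;
        last 4 first.
      + exact: Cg.
      + exact: Ch.
      + exact: Cg.
      + exact: Ch.
      by rewrite scalerBr opprD addrACA.
    - exact: affine_fun0.
    - exact/nonneg_affine_polyhedron/(pc_polyhedron (pcc_complex CC)).
  apply/seteqP; split=> g [Cg].
    move=> g_ge; split=> //; split=> [|x Qx].
      by rewrite addr0; exact: L_affine.
    by rewrite L_ge0//; exact: g_ge.
  by move=> [_ Lg]; split=> // x Qx; rewrite -L_ge0//; exact: Lg.
apply/seteqP; split=> g [Cg].
  move=> /(convex_iff_ge_affine_extensions _ Cg) g_ge; split=> //.
  by move=> [P Q] [PC _] x _; exact: g_ge.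
move=> g_ge; split=> //; apply/(convex_iff_ge_affine_extensions _ Cg) => P PC x.
have [Q QC Qx] := full_cell_cover x.
exact: (g_ge (P, Q)).
Qed.

Lemma affine_compatible g : affine_fun g -> compatible C g.
Proof. by move=> gA P _; exists g. Qed.

Lemma affine_convex g : affine_fun g -> convex_function setT g.
Proof.
move=> [a [b ->]]; apply/convex_functionP => t x y _ _.
rewrite linearD !linearZ/= le_eqVlt; apply/orP; left; apply/eqP; ring.
Qed.

Lemma cls0 : cls (0 : rfun R d) = 0.
Proof. by apply: (addIr (cls 0)); rewrite -clsD !add0r. Qed.

(** The functionals that define [A] are bounded above on the subspace of affine
functions, hence vanish there, and so are well defined on classes. *)
Lemma polyhedron_in_Vbar (A : set (rfun R d)) : @affine_fun R d `<=` A ->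
  polyhedron_in (compatible C) A -> polyhedron_in (Vbar C) (@cls R d @` A).
Proof.
move=> affA [n [phi [b [lphi AE]]]].
have phiZ i c k : affine_fun k -> phi i (c *: k) = c * phi i k.
  move=> kA; have C0 : compatible C 0.
    exact/affine_compatible/affine_fun0.
  have phi0 : phi i 0 = 0.
    by have := lphi i 1 0 0 C0 C0; rewrite scaler0 addr0 mul1r; lra.
  by rewrite -[c *: k]addr0 lphi ?phi0 ?addr0//; exact: affine_compatible.
have phi_affine i k : affine_fun k -> phi i k = 0.
  move=> kA; apply: contrapT => /eqP phik.
  (* On this multiple of k the functional takes the value b i + 1. *)
  have : A (((b i + 1) / phi i k) *: k).
    apply: affA; rewrite -[_ *: _]addr0; apply: affine_funP => //.
    exact: affine_fun0.
  by rewrite AE => -[_ /(_ i)]; rewrite phiZ// divfK//; lra.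
have compatible_shift g h : compatible C g -> affine_fun (h - g) ->
    compatible C h.
  move=> Cg hgA; rewrite -[h](subrK g) addrC -{1}[g]scale1r.
  by apply: compatible_submod_closed => //; exact: affine_compatible.
have phi_shift i g h : compatible C g -> affine_fun (h - g) ->
    phi i h = phi i g.
  move=> Cg hgA; rewrite -[h](subrK g) addrC -{1}[g]scale1r lphi//.
    by rewrite (phi_affine i _ hgA) addr0 mul1r.
  exact: affine_compatible.
exists n, (fun i u => phi i (repr u)), b.
have reprP g : affine_fun (repr (cls g) - g).
  by apply/clsP; rewrite /cls reprK.
have reprC u : Vbar C u -> compatible C (repr u).
  by move=> [g Cg <-]; exact: compatible_shift (reprP g).
split.
  move=> i a u v Cu Cv; rewrite -lphi; try exact: reprC.
  apply: phi_shift; first by apply: compatible_submod_closed; exact: reprC.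
  by apply/clsP; rewrite clsD clsZ /cls !reprK.
apply/seteqP; split=> u.
  rewrite AE => -[g [Cg gb] <-]; split; first by exists g.
  by move=> i; rewrite (phi_shift i g)//; exact: Cg.
move=> [Cu ub]; exists (repr u); last by rewrite /cls reprK.
by rewrite AE; split=> //; exact: reprC.
Qed.

Lemma Vbarplus_polyhedron : polyhedron_in (Vbar C) (Vbarplus C).
Proof.
apply: polyhedron_in_Vbar; last exact: compatible_convex_polyhedron.
by move=> g gA; split; [exact: affine_compatible|exact: affine_convex].
Qed.

Lemma Vbarplus0 : Vbarplus C 0.
Proof.
exists 0; last exact: cls0.
have A0 := @affine_fun0 R d.
by split; [exact: affine_compatible|exact: affine_convex].
Qed.

(** If [g] and [k] are convex with affine sum, then [g] and [k] dominate their
affine extensions from one and the same cell, which have the same sum as [g]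
and [k]; so both dominations are equalities. *)
Lemma Vbarplus_pointed (u : funmodAff R d) :
  Vbarplus C u -> Vbarplus C (- u) -> u = 0.
Proof.
move=> [g [Cg gconv] <-] [k [Ck kconv] kg].
have gkA : affine_fun (g + k).
  by rewrite -[k]opprK; apply/clsP; rewrite clsN kg opprK.
have [P PC _] := full_cell_cover 0.
have gP : affine_on P g by exact: Cg PC.1.
have kP : affine_on P k by exact: Ck PC.1.
have gkE : affine_extension P g + affine_extension P k = g + k.
  rewrite -[affine_extension P g]scale1r -affine_extension_linear ?scale1r//.
    by apply: affine_extension_unique => //; exact: PC.2.
  exact: PC.2.
have gE : g = affine_extension P g.
  apply/funext => x; apply/eqP; rewrite eq_le.
  have gx := (convex_iff_ge_affine_extensions g Cg).1 gconv P PC x.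
  have kx := (convex_iff_ge_affine_extensions k Ck).1 kconv P PC x.
  rewrite gx andbT.
  have : affine_extension P g x + affine_extension P k x = g x + k x.
    exact: (congr1 (fun f : rfun R d => f x) gkE).
  lra.
have [gA _] := affine_extensionP P g gP.
by rewrite -cls0; apply/clsP; rewrite subr0 gE.
Qed.

Lemma decomposition_is_polyhedron f :
  polyhedron_in (Vbar C `*` Vbar C) (decomposition_polyhedron C f).
Proof.
have Vlin (a : R) (u v : funmodAff R d) :
    Vbar C u -> Vbar C v -> Vbar C (a *: u + v).
  exact: Vbar_submod_closed.
have V0 := @Vbar0 R d C.
have VplusV u : Vbarplus C u -> Vbar C u by move=> [g [Cg _] <-]; exists g.
have [fV|nfV] := pselect (Vbar C (cls f)); last first.
  rewrite (_ : decomposition_polyhedron C f = set0).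
    exact: polyhedron_in0.
  apply/seteqP; split=> // -[u v] [/VplusV uV /VplusV vV fE]; apply: nfV.
  by rewrite fE addrC -scaleN1r; exact: Vlin.
have VN u : Vbar C u -> Vbar C (- u).
  by move=> uV; rewrite -scaleN1r -[_ *: _]addr0; exact: Vlin.
have VB u v : Vbar C u -> Vbar C v -> Vbar C (u - v).
  by move=> uV vV; rewrite addrC -scaleN1r; exact: Vlin.
have polyV := Vbarplus_polyhedron.
pose W := Vbar C `*` Vbar C.
(* The last two conditions say that p.1 - p.2 = cls f: the cone is pointed. *)
rewrite (_ : decomposition_polyhedron C f =
   ([set p | W p /\ Vbarplus C (p.1 + 0)] `&`
    [set p | W p /\ Vbarplus C (p.2 + 0)]) `&`
   ([set p | W p /\ Vbarplus C ((p.1 - p.2) + - cls f)] `&`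
    [set p | W p /\ Vbarplus C ((p.2 - p.1) + cls f)])).
  apply: polyhedron_inI; apply: polyhedron_inI.
  - by apply: (polyhedron_in_preimage _ _ _ (Vbar C)) => // x [].
  - by apply: (polyhedron_in_preimage _ _ _ (Vbar C)) => // x [].
  - apply: (polyhedron_in_preimage _ _ _ (Vbar C)) => //.
    + by move=> a u v _ _; rewrite scalerBr opprD addrACA.
    + by move=> x []; exact: VB.
    + exact: VN.
  - apply: (polyhedron_in_preimage _ _ _ (Vbar C)) => //.
    + by move=> a u v _ _; rewrite scalerBr opprD addrACA.
    + by move=> x [] ? ?; exact: VB.
apply/seteqP; split=> -[u v] /=.
  move=> [uV vV ->]; rewrite !addr0 subrr -[v - u]opprB addNr.
  have Wuv : W (u, v) by split; exact: VplusV.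
  by split; split=> //; split=> //; exact: Vbarplus0.
rewrite !addr0 => -[[[Wuv uV] [_ vV]] [[_ fV1] [_ fV2]]]; split=> //.
apply/esym/eqP; rewrite -subr_eq0; apply/eqP/Vbarplus_pointed => //.
by rewrite opprB addrC opprB.
Qed.

End Complex.
End Convexity.

Theorem proposition4p2 (R : realType) (d : nat) (f : rfun R d)
    (C : set (set 'rV[R]_d))
    (f_cpwl : cpwl f) (C_complex : pure_complete_complex C) :
  [/\ polyhedron_in (Vbar C `*` Vbar C) (decomposition_polyhedron C f),
      decomposition_polyhedron C f = (Vbarplus C `*` Vbarplus C) `&` Hf f,
      {in decomposition_polyhedron C f &, injective fst} &
      fst @` decomposition_polyhedron C f =
        Vbarplus C `&` [set g + cls f | g in Vbarplus C]].
Proof.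
have Vcpwl u : Vbarplus C u -> CPWLbar u.
  by move=> [g [Cg _] <-]; exists g => //; exists C.
split; first exact: decomposition_is_polyhedron.
- apply/seteqP; split=> [[u v] [uV vV fE]|[u v] [[uV vV] [_ _ fE]]].
    by split=> //; split=> //; exact: Vcpwl.
  by split.
- move=> [u v] [u' v']; rewrite !inE => -[_ _ /= fE] [_ _ /= fE'] /= uu'.
  by congr pair => //; move: fE; rewrite fE' uu' => /addrI/oppr_inj.
- apply/seteqP; split=> [_ [[u v] [/= uV vV fE] <-]|u [uV [v vV vE]]].
    by split=> //; exists v => //; rewrite fE addrC subrK.
  by exists (u, v) => //; split=> //=; rewrite -vE addrC addKr.
Qed.
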